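(* Let $A$ and $B$ be nontrivial commutative groups. (a) If $A$ is infinite, then $\operatorname{fdeg}(\delta_{0,b})=\infty$ for every $b\in B\setminus\{0\}$; in particular $\delta(A,B)=\infty$. (b) If there is no prime $p$ such that $A$ is a finite $p$-group and $B$ is a $p$-group, then there is $b\in B$ with $\operatorname{fdeg}(\delta_{0,b})=\infty$; in particular $\delta(A,B)=\infty$. (c) If for some prime $p$, $A$ is a finite $p$-group, say $A\cong\bigoplus_{i=1}^r \mathbb{Z}/p^{\alpha_i}\mathbb{Z}$ with $\alpha_1\ge\alpha_2\ge\dots\ge\alpha_r\ge 1$, and $B$ is a $p$-group of finite exponent $p^\beta$, then $$\delta(A,B)=\sum_{j=1}^r (p^{\alpha_j}-1)+(\beta-1)(p-1)p^{\alpha_1-1}.$$ (d) If for some prime $p$, $A$ is a finite $p$-group and $B$ is a $p$-group of infinite exponent, then every $f\in B^A$ has finite functional degree, but $\delta(A,B)=\infty$.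
   Context: For commutative groups $A,B$, $B^A$ denotes the commutative group (under pointwise addition) of all maps $A\to B$. For $a\in A$, the difference operator $\Delta_a:B^A\to B^A$ is $(\Delta_a f)(x)=f(x+a)-f(x)$. Let $\widetilde{\mathbb N}=\mathbb N\cup\{-\infty,\infty\}$ ($\mathbb N=\{0,1,2,\dots\}$), totally ordered with $-\infty$ least and $\infty$ greatest. The functional degree $\operatorname{fdeg}(f)\in\widetilde{\mathbb N}$ of $f\in B^A$ is: $-\infty$ if $f=0$; otherwise the least $n\in\mathbb N$ such that $\Delta_{a_1}\cdots\Delta_{a_{n+1}}f=0$ for all $a_1,\dots,a_{n+1}\in A$; and $\infty$ if no such $n$ exists. Define $\delta(A,B)=\sup\{\operatorname{fdeg}(f): f\in B^A\}$. For $a\in A$, $b\in B$, the delta function $\delta_{a,b}\in B^A$ is given by $\delta_{a,b}(a)=b$ and $\delta_{a,b}(x)=0$ for $x\ne a$. A $p$-group is a commutative group in which every element has order a power of $p$. *)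

(* Defs.v *)
From HB Require Import structures.
From mathcomp Require Import all_boot all_order all_algebra.
From mathcomp Require Import boolp.
Set Implicit Arguments. Unset Strict Implicit. Unset Printing Implicit Defensive.
Import Order.TTheory GRing.Theory Num.Theory.
Local Open Scope ring_scope.

Inductive xnat := NegInf | Fin of nat | PosInf.

Definition xle (x y : xnat) : bool :=
  match x, y with
  | NegInf, _ => true
  | _, PosInf => true
  | Fin m, Fin n => (m <= n)%N
  | _, _ => false
  end.

Lemma exists_asbool (P : nat -> Prop) : (exists n, P n) -> exists n, `[< P n >].
Proof. by case=> n Pn; exists n; apply/asboolP. Qed.

Definition xsup (S : xnat -> Prop) : xnat :=
  match pselect (exists n, forall x, S x -> xle x (Fin n)) with
  | left h => if `[< exists n, S (Fin n) >] then Fin (ex_minn (exists_asbool h))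
              else NegInf
  | right _ => PosInf
  end.

Section Fdeg.
Variables (A B : zmodType).

Definition Delta (a : A) (f : A -> B) : A -> B := fun x => f (x + a) - f x.

Definition vanishes (f : A -> B) (n : nat) : Prop :=
  forall s : seq A, size s = n.+1 -> forall x, foldr Delta f s x = 0.

Definition fdeg (f : A -> B) : xnat :=
  if `[< forall x, f x = 0 >] then NegInf else
  match pselect (exists n, vanishes f n) with
  | left h => Fin (ex_minn (exists_asbool h))
  | right _ => PosInf
  end.

Definition delta_fun (a : A) (b : B) : A -> B := fun x => if x == a then b else 0.

End Fdeg.

Definition delta (A B : zmodType) : xnat :=
  xsup (fun d => exists f : A -> B, fdeg f = d).

Definition nontrivial (G : zmodType) : Prop := exists x : G, x != 0.
Definition finite_group (G : zmodType) : Prop := exists s : seq G, forall x, x \in s.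
Definition pgroup (p : nat) (G : zmodType) : Prop :=
  forall x : G, exists k, x *+ (p ^ k) = 0.
Definition exponent_is (G : zmodType) (n : nat) : Prop :=
  (0 < n)%N /\ (forall x : G, x *+ n = 0) /\
  (forall m, (0 < m)%N -> (forall x : G, x *+ m = 0) -> (n <= m)%N).
Definition infinite_exponent (G : zmodType) : Prop :=
  forall m, (0 < m)%N -> exists x : G, x *+ m != 0.

(* psi : Z^r -> A is a surjective homomorphism with kernel ⊕ p^{α_i} Z,
   i.e. A ≅ ⊕_{i} Z/p^{α_i}Z *)
Definition presents (A : zmodType) (p : nat) (al : seq nat)
  (psi : 'rV[int]_(size al) -> A) : Prop :=
  (forall u v, psi (u + v) = psi u + psi v) /\
  (forall a : A, exists v, psi v = a) /\
  (forall v, psi v = 0 <-> forall i : 'I_(size al), (((p ^ (nth 0%N al i))%N)%:Z %| v ord0 i)%Z).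

(* Main.v *)
(** Vanishing of all [n]-fold differences can be tested on generators, so one studies
    products of commuting operators [Delta_(e_j)].

    Expanding [Delta_(a_1) ... Delta_(a_n)] of the delta function at minus the sum of the
    [a_i] gives [b] as soon as no nonempty subfamily of the [a_i] sums to zero; an infinite
    group contains such families of every length. If [l c = 0] and [Delta_c ^ (n+1)] kills
    [f], then [l ^ n] kills [Delta_c f], so a delta function of finite degree has
    [l]-primary value for every prime [l] dividing the order of [A].

    For the [p]-group case, [e_j] of order [p ^ al_j] gives
    [Delta ^ (p ^ al_j) = - sum_(0 < k < p ^ al_j) 'C(p ^ al_j, k) Delta ^ k], [Delta = Delta_(e_j)].
    Give [p] the weight [q = (p - 1) p ^ (al_1 - 1)] and each [Delta_(e_j)] the weight 1.
    Rewriting with this relation never lowers the weight, and reduced monomials have degree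
    at most [sum (p ^ al_j - 1)]; hence a large weight forces a factor [p ^ beta], which is
    the upper bound. For [j = 1] the only term of minimal weight is [k = p ^ (al_1 - 1)],
    whose coefficient is [p] times a unit modulo [p]; following it shows that the bound is
    attained by a delta function. *)
Require Import Defs.
From mathcomp Require Import all_boot all_order all_algebra.
From mathcomp Require Import boolp zify.
Set Implicit Arguments. Unset Strict Implicit. Unset Printing Implicit Defensive.
Import GRing.Theory.
Local Open Scope ring_scope.

Local Notation Deltas := (foldr (@Delta _ _)).

(** * Iterated differences and their values on delta functions *)

Section Differences.
Variables A B : zmodType.
Implicit Types (f g : A -> B) (a x : A) (s t : seq A).

Lemma DeltaC a c f : Delta a (Delta c f) = Delta c (Delta a f).
Proof.
by apply/funext => x; rewrite /Delta (addrAC x a c) !opprD !opprK addrACA.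
Qed.

Lemma foldr_Delta_comm a f s :
  Deltas (Delta a f) s = Delta a (Deltas f s).
Proof. by elim: s => //= c s ->; rewrite DeltaC. Qed.

Lemma foldr_Delta_catC f s t :
  Deltas f (s ++ t) = Deltas f (t ++ s).
Proof.
elim: s => [|a s IH]; first by rewrite cats0.
by rewrite cat_cons /= IH !foldr_cat /= foldr_Delta_comm.
Qed.

Lemma foldr_Delta_perm f s t : perm_eq s t ->
  Deltas f s = Deltas f t.
Proof.
move=> st; pose P u := Deltas f s = Deltas f u.
apply: (catCA_perm_ind (P := P) _ st) => // s1 s2 s3.
by rewrite /P => ->; rewrite !catA foldr_cat foldr_Delta_catC -foldr_cat.
Qed.

Lemma foldr_Delta0 f s : (forall x, f x = 0) ->
  forall x, Deltas f s x = 0.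
Proof. by move=> f0; elim: s => //= a s IH x; rewrite /Delta !IH subrr. Qed.

Lemma foldr_Delta_muln f n s x :
  Deltas (fun y => f y *+ n) s x = Deltas f s x *+ n.
Proof. by elim: s x => //= a s IH x; rewrite /Delta !IH mulrnBl. Qed.

Lemma foldr_Delta_shift f a s x :
  Deltas (fun y => f (y + a)) s x = Deltas f s (x + a).
Proof. by elim: s x => //= c s IH x; rewrite /Delta !IH addrAC. Qed.

Lemma foldr_DeltaD f g s x :
  Deltas (fun y => f y + g y) s x =
  Deltas f s x + Deltas g s x.
Proof. by elim: s x => //= c s IH x; rewrite /Delta !IH opprD addrACA. Qed.

Lemma foldr_DeltaN f s x :
  Deltas (fun y => - f y) s x = - Deltas f s x.
Proof. by elim: s x => //= c s IH x; rewrite /Delta !IH opprD. Qed.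

Lemma vanishes_leq f m n : (m <= n)%N -> vanishes f m -> vanishes f n.
Proof.
move=> mn fm s ss x.
have sd : size (drop (n - m) s) = m.+1 by rewrite size_drop ss; lia.
rewrite -(cat_take_drop (n - m) s) foldr_cat.
by apply: foldr_Delta0 => y; apply: fm.
Qed.

(** An iterated difference is a signed sum of values of [f] at [x] plus the subsums of [s]; here
    only the full subsum survives, and its sign is positive. *)
Lemma foldr_Delta_eval f s x :
    (forall m, size m = size s -> ~~ all id m -> f (x + \sum_(a <- mask m s) a) = 0) ->
  Deltas f s x = f (x + \sum_(a <- s) a).
Proof.
elim: s x => [|a s IH] x fm /=; first by rewrite big_nil addr0.
rewrite /Delta (IH (x + a)); last first.
  by move=> m sm mN; have := fm (true :: m); rewrite /= sm big_cons addrA => ->.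
rewrite (IH x); last first.
  by move=> m sm mN; have := fm (false :: m); rewrite /= sm; apply.
have := fm (false :: nseq (size s) true); rewrite /= size_nseq mask_true // => -> //.
by rewrite subr0 big_cons addrA.
Qed.

Lemma sum_mask_negb m s : size m = size s ->
  \sum_(a <- s) a = \sum_(a <- mask m s) a + \sum_(a <- mask (map negb m) s) a.
Proof.
elim: m s => [|c m IH] [|a s] //=; first by rewrite !big_nil addr0.
by case=> /IH; case: c => /=; rewrite !big_cons => ->; [rewrite addrA | rewrite addrCA].
Qed.

(** Starting from minus the total, the subsum of a mask leads to minus the complementary subsum,
    nonzero unless the mask is full. *)
Lemma foldr_Delta_delta_fun (b : B) s :
    (forall m, size m = size s -> has id m -> \sum_(a <- mask m s) a != 0) ->
  Deltas (delta_fun (0 : A) b) s (- \sum_(a <- s) a) = b.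
Proof.
move=> sN; rewrite foldr_Delta_eval ?addNr /delta_fun ?eqxx // => m sm mN.
rewrite (sum_mask_negb sm) opprD addrAC addNr add0r oppr_eq0.
rewrite (negPf (sN _ _ _)) ?size_map // has_map.
by move: mN; rewrite -has_predC; apply: sub_has => c.
Qed.

(** Translation by [a] is [1 + Delta a]; this is the binomial expansion of its [n]-th power. *)
Lemma Newton_forward f a n x :
  f (x + a *+ n) = \sum_(k < n.+1) Deltas f (nseq k a) x *+ 'C(n, k).
Proof.
elim: n x => [|n IH] x; first by rewrite big_ord1 mulr0n addr0 /= bin0 mulr1n.
rewrite mulrS addrA IH [RHS]big_ord_recl bin0 mulr1n /=.
under [in RHS]eq_bigr => k _ do rewrite /bump /= add1n binS mulrnDr.
rewrite big_split /= addrA [X in _ + X + _]big_ord_recr /= bin_small // mulr0n addr0.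
rewrite -[X in X + _ + _]mulr1n -[in X in X + _ + _](bin0 n).
have := big_ord_recl n (fun k : 'I_n.+1 => Deltas f (nseq k a) x *+ 'C(n, k)).
rewrite /= => <-; rewrite -big_split /=; apply: eq_bigr => k _.
by rewrite /Delta -mulrnDl subrKC.
Qed.

Lemma foldr_Delta_nseq_order f a n x : (0 < n)%N -> a *+ n = 0 ->
  Deltas f (nseq n a) x =
  - \sum_(1 <= k < n) Deltas f (nseq k a) x *+ 'C(n, k).
Proof.
move=> n0 an; have := Newton_forward f a n x.
rewrite an addr0 -(big_mkord xpredT (fun k => Deltas f (nseq k a) x *+ 'C(n, k))).
rewrite big_nat_recr //= binn big_ltn // bin0 !mulr1n -addrA => /eqP.
by rewrite -[X in X == _]addr0 (inj_eq (addrI _)) eq_sym addrC addr_eq0 => /eqP.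
Qed.

Lemma foldr_Delta_torsion f a l n : a *+ l = 0 ->
    (forall x, Deltas f (nseq n.+1 a) x = 0) ->
  forall x, Delta a f x *+ l ^ n = 0.
Proof.
move=> al; elim: n f => [|n IH] f fn x; first by rewrite expn0 mulr1n; apply: fn.
rewrite expnS mulrnA; have := IH (fun y => f y *+ l) _ x.
rewrite /Delta -mulrnBl => ->// y; rewrite foldr_Delta_muln.
set g := Deltas f (nseq n a); rewrite -[foldr _ _ _]/(Delta a g).
(* Two differences along [a] kill [g], so [g] is affine along [a]; [k = l], where [a *+ l = 0], then
   shows that [l] kills [Delta a g]. *)
have gS k z : g (z + a *+ k) = g z + Delta a g z *+ k.
  elim: k => [|k IHk]; first by rewrite !mulr0n !addr0.
  have : Delta a g (z + a *+ k) = Delta a g z.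
    elim: k {IHk} => [|k IHk]; first by rewrite addr0.
    rewrite mulrSr addrA -IHk; apply/eqP; rewrite -subr_eq0; apply/eqP.
    exact: (fn (z + a *+ k)).
  rewrite {1}/Delta -addrA -mulrSr => /eqP; rewrite subr_eq IHk => /eqP ->.
  by rewrite mulrSr addrCA addrA addrAC -addrA [_ *+ k + _]addrC addrA.
have /eqP := gS l y; rewrite al addr0 -[X in X == _]addr0 (inj_eq (addrI _)).
by rewrite eq_sym => /eqP.
Qed.

End Differences.

(** * Powers of [p] in binomial coefficients *)

(** Since [p ^ a] divides [k * 'C(p ^ a, k)], the valuations of the two factors add up to at least
    [a]. The excluded [k] would give equality with [e = 1]. *)
Lemma bin_pfactor_weight p a k : prime p -> (0 < a)%N -> (0 < k < p ^ a)%N ->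
    k != (p ^ (a - 1))%N ->
  exists e, [/\ (0 < e)%N, (p ^ e %| 'C(p ^ a, k))%N &
                (p ^ a < k + e * ((p - 1) * p ^ (a - 1)))%N].
Proof.
move=> pp a0 /andP[k0 kpa] kN; have p1 := prime_gt1 pp.
have pa : (p ^ a = p * p ^ (a - 1))%N by rewrite -expnS subn1 prednK.
have P0 : (0 < p ^ (a - 1))%N by rewrite expn_gt0 prime_gt0.
have C0 : (0 < 'C(p ^ a, k))%N by rewrite bin_gt0 ltnW.
have : (a <= logn p k + logn p 'C(p ^ a, k))%N.
  rewrite -lognM // -pfactor_dvdn // ?muln_gt0 ?k0 //.
  by case: k k0 {kpa kN C0} => // k _; rewrite -mul_bin_diag dvdn_mulr.
case: (boolP (p ^ (a - 1) %| k)%N) => [/dvdnP[l kl] alog | ndv alog].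
  have l1 : (1 < l)%N by case: l kl => [|[|l]] // kl; move: k0 kN; rewrite kl // mul1n eqxx.
  exists 1; split=> //; last by rewrite pa kl mul1n -mulnDl ltn_pmul2r //; lia.
  rewrite expn1 -[X in (X %| _)%N]expn1 pfactor_dvdn //.
  have : (logn p k < a)%N by rewrite ltnNge -pfactor_dvdn // gtnNdvd.
  lia.
(* Now [logn p k <= a - 2]; the weight grows because [2 * (p - 1) >= p] and [k > 0]. *)
exists 2; split=> //; last first.
  by rewrite pa mulnA -[X in (X < _)%N]add0n -addSn leq_add // leq_mul2r; lia.
rewrite pfactor_dvdn //.
have : (logn p k < a - 1)%N by rewrite ltnNge -pfactor_dvdn.
lia.
Qed.

(** As [p] divides ['C(p ^ a, k.+1)], Pascal's rule would pass divisibility by [p] down from [k.+1]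
    to [k], and finally to 1. *)
Lemma coprime_bin_pfactor_pred p a k : prime p -> (k < p ^ a)%N ->
  coprime p 'C((p ^ a).-1, k).
Proof.
move=> pp; have P0 : (0 < p ^ a)%N by rewrite expn_gt0 prime_gt0.
rewrite prime_coprime //; elim: k => [|k IH] kpa; first by rewrite bin0 dvdn1 neq_ltn prime_gt1 ?orbT.
apply: contra (IH (ltnW kpa)) => dv.
suff : (p %| 'C(p ^ a, k.+1))%N by rewrite -[X in 'C(X, _)](prednK P0) binS dvdn_addr.
have C0 : (0 < 'C(p ^ a, k.+1))%N by rewrite bin_gt0 ltnW.
have : (a <= logn p k.+1 + logn p 'C(p ^ a, k.+1))%N.
  by rewrite -lognM // -pfactor_dvdn // ?muln_gt0 // -mul_bin_diag dvdn_mulr.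
have : (logn p k.+1 < a)%N by rewrite ltnNge -pfactor_dvdn // gtnNdvd.
by rewrite -[X in (X %| _)%N]expn1 pfactor_dvdn //; lia.
Qed.

Lemma bin_pfactor_predexp p a : prime p -> (0 < a)%N ->
  exists2 c, 'C(p ^ a, p ^ (a - 1)) = (p * c)%N & coprime p c.
Proof.
move=> pp a0; have P0 : (0 < p ^ (a - 1))%N by rewrite expn_gt0 prime_gt0.
have pa : (p ^ a = p ^ (a - 1) * p)%N by rewrite -expnSr subn1 prednK.
exists 'C((p ^ a).-1, (p ^ (a - 1)).-1).
  apply/eqP; rewrite -(eqn_pmul2l P0); apply/eqP.
  have := mul_bin_diag (p ^ a) (p ^ (a - 1)).-1; rewrite prednK // => <-.
  by rewrite mulnA -pa.
apply: coprime_bin_pfactor_pred => //; rewrite pa.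
by have := prime_gt1 pp; nia.
Qed.

(** * Weighted reduction of difference monomials, with counting preliminaries *)

Lemma coprime_mulrn_eq0 (G : zmodType) (y : G) m n :
  coprime m n -> y *+ m = 0 -> y *+ n = 0 -> y = 0.
Proof.
case: m => [|m]; first by rewrite /coprime gcd0n => /eqP -> _; rewrite mulr1n.
move=> /eqP mn ym yn; have [a _ /dvdnP[b]] := Bezoutl n (ltn0Sn m).
rewrite mn => abE; have : y *+ (1 + a * n) = 0 by rewrite abE mulnC mulrnA ym mul0rn.
by rewrite mulrnDr mulr1n mulnC mulrnA yn mul0rn addr0.
Qed.

Lemma size_sum_count (T : finType) (t : seq T) : size t = (\sum_j count_mem j t)%N.
Proof.
elim: t => [|i t IH] /=; first by rewrite big1.
rewrite big_split /= -IH (bigD1 i) //= eqxx big1 ?addn0 // => j /negPf.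
by rewrite eq_sym => ->.
Qed.

Lemma perm_nseq_count (T : eqType) (t : seq T) j n : (n <= count_mem j t)%N ->
  exists t', perm_eq t (nseq n j ++ t').
Proof.
move=> nt; exists (nseq (count_mem j t - n) j ++ filter (predC1 j) t).
rewrite catA -nseqD subnKC //.
suff -> : nseq (count_mem j t) j = filter (pred1 j) t by rewrite perm_sym perm_filterC.
elim: t {nt} => //= i t IH; case: eqP => [->|] /=; first by rewrite IH.
by rewrite add0n.
Qed.

(* A monomial [p ^ i * Delta_(e t_1) ... Delta_(e t_k)] gets weight [k + i * q]. Expanding
   [Delta_(e j) ^ (p ^ al j)] by means of [e j *+ p ^ al j = 0] only produces terms of at
   least the same weight, but with larger [i]. *)
Section Weights.
Variables (A B : zmodType) (r : nat) (e : 'I_r -> A) (al : 'I_r -> nat).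
Variables (p q beta : nat) (f : A -> B).
Hypotheses (pp : prime p) (al0 : forall j, (0 < al j)%N).
Hypothesis eal : forall j, e j *+ p ^ al j = 0.
Hypothesis leq_q : forall j, ((p - 1) * p ^ (al j - 1) <= q)%N.
Hypothesis fbeta : forall x, f x *+ p ^ beta = 0.

Lemma Deltas_weight_eq0 i (t : seq 'I_r) :
    (\sum_j (p ^ al j - 1) + (beta - 1) * q < size t + i * q)%N ->
  forall x, Deltas f (map e t) x *+ p ^ i = 0.
Proof.
have [m] := ubnP (beta - i); elim: m i t => // m IH i t im wt x.
case: (leqP beta i) => [bi | ib].
  rewrite -(subnKC bi) expnD mulrnA -foldr_Delta_muln.
  by rewrite foldr_Delta0 ?mul0rn.
(* Pigeonhole: if all multiplicities were smaller, then, as [i <= beta - 1], the weight would not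
   exceed the bound. *)
have [j jt] : exists j, (p ^ al j <= count_mem j t)%N.
  apply/existsP; apply: contraLR wt; rewrite negb_exists => /forallP tN.
  rewrite -leqNgt; apply: leq_add; last by rewrite leq_mul2r; lia.
  rewrite size_sum_count; apply: leq_sum => j _.
  by have := tN j; rewrite -ltnNge => tj; rewrite -ltnS subn1 prednK ?expn_gt0 ?prime_gt0.
have [t' tt'] := perm_nseq_count jt.
rewrite (foldr_Delta_perm f (perm_map e tt')) map_cat foldr_cat map_nseq.
have st := perm_size tt'; rewrite size_cat size_nseq in st.
rewrite foldr_Delta_nseq_order ?expn_gt0 ?prime_gt0 ?eal // mulNrn.
apply/eqP; rewrite oppr_eq0 big_nat -sumrMnl big1 // => k kpa.
(* A weak inequality suffices: progress comes from [d > 0], which brings the power of [p] closer to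
   [beta]. *)
have [d [d0 /dvdnP[c ->] dw]] : exists d, [/\ (0 < d)%N, (p ^ d %| 'C(p ^ al j, k))%N &
    (p ^ al j <= k + d * ((p - 1) * p ^ (al j - 1)))%N].
  have [->|kN] := eqVneq k (p ^ (al j - 1))%N.
    exists 1; split=> //; last first.
      have := prime_gt0 pp; rewrite -{1}(prednK (al0 j)) expnS subn1; nia.
    by have [c -> _] := bin_pfactor_predexp pp (al0 j); rewrite dvdn_mulr.
  have [d [d0 dC /ltnW dw]] := bin_pfactor_weight pp (al0 j) kpa kN.
  by exists d.
rewrite -mulrnA -mulnA -expnD [(c * _)%N]mulnC mulrnA -foldr_cat -map_nseq -map_cat.
rewrite IH ?mul0rn //; first by lia.
rewrite size_cat size_nseq; move: wt; rewrite st.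
have : (d * ((p - 1) * p ^ (al j - 1)) <= d * q)%N by rewrite leq_mul.
move=> dq /leq_trans; apply.
by rewrite mulnDl addnA leq_add2r addnAC leq_add2r (leq_trans dw) // leq_add2l.
Qed.

(* Modulo terms of larger weight, [Delta_(e j0) ^ (p ^ al j0)] equals
   [- 'C(p ^ al j0, p ^ (al j0 - 1))] times [Delta_(e j0) ^ (p ^ (al j0 - 1))], and this
   binomial coefficient is exactly divisible by [p]. *)
Lemma Deltas_weight_reduce j0 (T : seq 'I_r) m x :
    q = ((p - 1) * p ^ (al j0 - 1))%N ->
    (\sum_j (p ^ al j - 1) = size T + (p ^ al j0 - 1))%N -> (m < beta)%N ->
    Deltas f (map e (nseq (p ^ al j0 - 1 + m * q) j0 ++ T)) x *+ p ^ (beta - 1 - m) = 0 ->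
  Deltas f (map e (nseq (p ^ al j0 - 1) j0 ++ T)) x *+ p ^ (beta - 1) = 0.
Proof.
move=> qE sT; have p1 := prime_gt1 pp.
have P0 : (0 < p ^ (al j0 - 1))%N by rewrite expn_gt0 prime_gt0.
have pa : (p ^ al j0 = p ^ (al j0 - 1) + q)%N.
  by rewrite qE -{1}(prednK (al0 j0)) expnS subn1 -[X in (X + _)%N]mul1n -mulnDl subnKC // ltnW.
have q0 : (0 < q)%N by rewrite qE muln_gt0 P0 subn_gt0 p1.
elim: m => [|m IH] mb; first by rewrite mul0n addn0 subn0.
move=> D0; apply: IH; first exact: ltnW.
set y := _ *+ _; have [c cE cop] := bin_pfactor_predexp pp (al0 j0).
have yp : y *+ p ^ m.+1 = 0.
  rewrite /y -mulrnA -expnD -foldr_Delta_muln foldr_Delta0 // => z.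
  by rewrite (_ : (beta - 1 - m + m.+1 = beta)%N) //; lia.
(* The unit part [c] of the binomial coefficient can be cancelled, as [y] is [p]-primary. *)
suff yc : y *+ c = 0.
  apply: (coprime_mulrn_eq0 _ yp yc); exact: coprimeXl.
apply/eqP; rewrite -oppr_eq0 -{}D0; apply/eqP.
have -> : (p ^ al j0 - 1 + m.+1 * q = p ^ al j0 + (q - 1 + m * q))%N by rewrite mulSn; lia.
rewrite nseqD -catA map_cat foldr_cat map_nseq.
rewrite foldr_Delta_nseq_order ?expn_gt0 ?prime_gt0 ?eal // mulNrn; congr (- _).
rewrite (bigD1_seq (p ^ (al j0 - 1))%N) /=; last exact: iota_uniq; last first.
  by rewrite mem_index_iota P0 pa -[X in (X < _)%N]addn0 ltn_add2l.
rewrite mulrnDl big_nat_cond -sumrMnl big1 ?addr0; last first.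
  (* The product being rewritten sits exactly at the bound of [Deltas_weight_eq0]; every other [k]
     strictly exceeds it and contributes 0. *)
  move=> k /andP[kpa kN].
  have [d [d0 /dvdnP[g ->] dw]] := bin_pfactor_weight pp (al0 j0) kpa kN.
  rewrite -mulrnA -mulnA -expnD [(g * _)%N]mulnC mulrnA -foldr_cat -map_nseq -map_cat.
  rewrite Deltas_weight_eq0 ?mul0rn // sT !size_cat !size_nseq.
  have bq : (beta - 1 = m.+1 + (beta - 1 - m.+1))%N by lia.
  have := leq_addl (p ^ (al j0 - 1)) q; rewrite -pa => /(leq_trans q0).
  rewrite {1}bq; move: dw; rewrite -qE !mulnDl mulSn.
  move: (p ^ al j0)%N (size T) (d * q)%N (m * q)%N ((beta - 1 - m.+1) * q)%N.
  by move=> *; lia.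
rewrite /y cE [(p * c)%N]mulnC -!mulrnA -mulnA -expnS -foldr_cat -map_nseq -map_cat catA -nseqD.
rewrite [(_ * c)%N]mulnC (_ : (beta - 1 - m = (beta - 1 - m.+1).+1)%N); last by lia.
by rewrite (_ : (p ^ al j0 - 1 + m * q = p ^ (al j0 - 1) + (q - 1 + m * q))%N) // pa; lia.
Qed.

End Weights.

(** * Reduction to generators *)

(** Phrased as an induction principle, so that it can be used directly with [elim/gen]. *)
Definition generates (A : zmodType) (r : nat) (e : 'I_r -> A) : Prop :=
  forall P : A -> Prop, P 0 -> (forall a c, P a -> P c -> P (a + c)) ->
    (forall a, P a -> P (- a)) -> (forall j, P (e j)) -> forall a, P a.

(** Up to translations, [Delta (a + c)] is [Delta a + Delta c] and [Delta (- a)] is [- Delta a], so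
    directions can be replaced by generators one at a time. *)
Lemma Deltas_generators (A B : zmodType) r (e : 'I_r -> A) (f : A -> B) n :
    generates e ->
    (forall t, size t = n -> forall x, Deltas f (map e t) x = 0) ->
  forall s, size s = n -> forall x, Deltas f s x = 0.
Proof.
move=> gen; elim: n f => [|n IH] f ft s.
  by move/size0nil=> -> x; apply: (ft [::]).
case: s => // a s [ss] x; rewrite /= -foldr_Delta_comm; apply: IH => //.
elim/gen: a {s ss x} => [t st x|a c IHa IHc t st x|a IHa t st x|j t st x].
- by apply: foldr_Delta0 => y; rewrite /Delta addr0 subrr.
- have -> : Delta (a + c) f = fun y => Delta a f (y + c) + Delta c f y.
    by apply/funext => y; rewrite /Delta addrA subrKA addrAC.
  by rewrite foldr_DeltaD (foldr_Delta_shift (Delta a f)) IHa // IHc // addr0.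
- have -> : Delta (- a) f = fun y => - Delta a f (y - a).
    by apply/funext => y; rewrite /Delta subrK opprB.
  by rewrite foldr_DeltaN (foldr_Delta_shift (Delta a f)) IHa // oppr0.
- by rewrite foldr_Delta_comm; apply: (ft (j :: t)); rewrite /= st.
Qed.

(** * Functional degree and its supremum *)

Section FunctionalDegree.
Variables A B : zmodType.
Implicit Types f g : A -> B.

Lemma fdeg_leP f n : xle (fdeg f) (Fin n) <-> vanishes f n.
Proof.
rewrite /fdeg; case: asboolP => [f0|_].
  by split=> // _ s _ x; apply: foldr_Delta0.
case: pselect => [h|h] /=; last by split=> // fn; case: h; exists n.
case: ex_minnP => m /asboolP fm mmin; split=> [mn|fn].
  exact: vanishes_leq fm.
by apply/mmin/asboolP.
Qed.

Lemma fdeg_PosInf f : (forall n, ~ vanishes f n) -> fdeg f = PosInf.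
Proof.
move=> fN; case E: (fdeg f) => [|n|//].
  by case: (fN 0%N); apply/fdeg_leP; rewrite E.
by case: (fN n); apply/fdeg_leP; rewrite E /=.
Qed.

Lemma fdeg_Fin f n : vanishes f n.+1 -> ~ vanishes f n -> fdeg f = Fin n.+1.
Proof.
move=> /fdeg_leP fn fN; case E: (fdeg f) fn => [|m|//] /=.
  by case: fN; apply/fdeg_leP; rewrite E.
rewrite leq_eqVlt => /predU1P[-> //|mn].
by case: fN; apply/fdeg_leP; rewrite E.
Qed.

Lemma delta_PosInf : (forall n, exists f, ~ vanishes f n) -> delta A B = PosInf.
Proof.
move=> H; rewrite /delta /xsup; case: pselect => // -[n fn].
by have [f []] := H n; apply/fdeg_leP/fn; exists f.
Qed.

Lemma delta_Fin n f : (forall g, vanishes g n) -> fdeg f = Fin n -> delta A B = Fin n.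
Proof.
move=> gn fE; rewrite /delta /xsup; case: pselect => [h|[]]; last first.
  by exists n => _ [g <-]; apply/fdeg_leP.
case: asboolP => [_|[]]; last by exists n, f.
case: ex_minnP => m /asboolP mub mmin; congr Fin; apply/eqP; rewrite eqn_leq.
have -> /= : (n <= m)%N by apply: (mub (Fin n)); exists f.
by rewrite andbT; apply/mmin/asboolP => _ [g <-]; apply/fdeg_leP.
Qed.

(** As [c != 0], the difference along [c] of the delta function takes the value [b] at [- c]. *)
Lemma vanishes_delta_fun_torsion (b : B) (c : A) l n : c != 0 -> c *+ l = 0 ->
  vanishes (delta_fun (0 : A) b) n -> b *+ l ^ n = 0.
Proof.
move=> c0 cl bn; have := foldr_Delta_torsion cl (bn _ (size_nseq n.+1 c)) (- c).
by rewrite /Delta addNr /delta_fun eqxx oppr_eq0 (negPf c0) subr0.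
Qed.

End FunctionalDegree.

(** * Infinite domains, torsion and distinct primes *)

(** A family extends by any element outside the finite list of negated subsums. *)
Lemma infinite_zero_sum_free (A : zmodType) n : ~ finite_group A ->
  exists2 s : seq A, size s = n &
    forall m, size m = size s -> has id m -> \sum_(a <- mask m s) a != 0.
Proof.
move=> Ainf; elim: n => [|n [s ss sN]]; first by exists [::] => // -[].
pose sums := [seq - \sum_(a <- mask (val m) s) a | m : n.-tuple bool].
have [a aN] : exists a, a \notin sums.
  apply: contrapT => aN; apply: Ainf; exists sums => x.
  by apply/negPn/negP => xN; apply: aN; exists x.
exists (a :: s); rewrite /= ?ss // => -[//|[] m] [sm] /= mN; last by apply: sN; rewrite ?sm.
rewrite big_cons addr_eq0; apply: contra aN => /eqP ->.
have smn : size m == n by rewrite sm.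
by apply/imageP; exists (Tuple smn).
Qed.

Lemma torsion_prime_order (G : zmodType) (y : G) n : (0 < n)%N -> y != 0 -> y *+ n = 0 ->
  exists l c, [/\ prime l, (l %| n)%N, c != 0 & c *+ l = 0 :> G].
Proof.
have [m] := ubnP n; elim: m n y => // m IH n y nm n0 y0 yn.
have n1 : (1 < n)%N.
  by rewrite ltn_neqAle n0 andbT eq_sym; apply: contraNneq y0 => n1; rewrite -yn n1.
have lp := pdiv_prime n1; have dv := pdiv_dvd n.
have [yl|yl] := eqVneq (y *+ (n %/ pdiv n)) 0; last first.
  by exists (pdiv n), (y *+ (n %/ pdiv n)); split=> //; rewrite -mulrnA divnK.
have n'n : (n %/ pdiv n < n)%N by rewrite ltn_Pdiv ?prime_gt1.
have [||l [c [l1 l2 l3 l4]]] := IH (n %/ pdiv n)%N y _ _ y0 yl.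
- exact: leq_trans n'n _.
- by rewrite divn_gt0 ?pdiv_gt0 // dvdn_leq.
exists l, c; split=> //; apply: dvdn_trans l2 _.
by rewrite -[X in (_ %| X)%N](divnK dv) dvdn_mulr.
Qed.

Lemma finite_group_torsion (G : zmodType) (y : G) : finite_group G ->
  exists2 n, (0 < n)%N & y *+ n = 0.
Proof.
case=> s sG; pose t := [seq y *+ k | k <- iota 0 (size s).+1].
have : ~~ uniq t.
  apply/negP => /uniq_leq_size /(_ (fun x _ => sG x)).
  by rewrite size_map size_iota ltnn.
move=> /(uniqPn 0)[i [j [ij]]]; rewrite size_map size_iota => js.
rewrite !(nth_map 0%N) ?size_iota ?(ltn_trans ij) // !nth_iota ?(ltn_trans ij) // !add0n.
move=> yij; exists (j - i)%N; first by rewrite subn_gt0.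
by rewrite mulrnBr ?yij ?subrr // ltnW.
Qed.

Lemma pgroup_seq_exponent p (G : zmodType) (s : seq G) : pgroup p G ->
  exists k, forall x, x \in s -> x *+ p ^ k = 0.
Proof.
move=> pG; elim: s => [|y s [k IH]]; first by exists 0%N.
have [l yl] := pG y; exists (k + l)%N => x; rewrite inE => /predU1P[->|xs].
  by rewrite addnC expnD mulrnA yl mul0rn.
by rewrite expnD mulrnA IH // mul0rn.
Qed.

Lemma infinite_vanishesN (A B : zmodType) (b : B) n : ~ finite_group A -> b != 0 ->
  ~ vanishes (delta_fun (0 : A) b) n.
Proof.
move=> Ainf b0 bn; have [s ss sN] := infinite_zero_sum_free n.+1 Ainf.
by case/eqP: b0; rewrite -(foldr_Delta_delta_fun b sN) bn.
Qed.

(** If every delta function had finite degree, each prime order occurring in [A] would make [B]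
    primary for that prime; two primes would then kill [b0]. *)
Lemma finite_non_pgroup_vanishesN (A B : zmodType) :
    nontrivial A -> nontrivial B -> finite_group A ->
    (~ exists p, [/\ prime p, finite_group A, pgroup p A & pgroup p B]) ->
  exists b : B, forall n, ~ vanishes (delta_fun (0 : A) b) n.
Proof.
move=> [a0 a0N] [b0 b0N] fA noP.
suff [l [c [b [c0 cl bN]]]] : exists l (c : A) (b : B),
    [/\ c != 0, c *+ l = 0 & forall k, b *+ l ^ k <> 0].
  by exists b => n /(vanishes_delta_fun_torsion c0 cl)/bN.
apply: contrapT => H.
have pB l (c : A) : c != 0 -> c *+ l = 0 -> pgroup l B.
  move=> c0 cl b; apply: contrapT => bN; apply: H; exists l, c, b.
  by split=> // k bk; apply: bN; exists k.
have [n0 n00 an0] := finite_group_torsion a0 fA.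
have [l0 [c0 [pl0 _ c00 cl0]]] := torsion_prime_order n00 a0N an0.
apply: noP; exists l0; split=> //; last exact: pB cl0.
move=> a; apply: contrapT => aN.
have [n nn0 an] := finite_group_torsion a fA.
(* Removing the [l0]-part of the order of [a] leaves a nonzero element, whence an element of prime
   order [l] different from [l0]. *)
have yN : a *+ n`_l0 != 0 by apply/eqP => a0'; apply: aN; exists (logn l0 n); rewrite -p_part.
have [|l [c [pl ln c1 cl]]] := torsion_prime_order (part_gt0 l0^' n) yN.
  by rewrite -mulrnA partnC.
have ll0 : coprime l0 l.
  rewrite prime_coprime // dvdn_prime2 //.
  have := pnat_dvd ln (part_pnat l0^' n); rewrite pnatE // inE /= inE.
  by rewrite eq_sym.
have [k bk] := pB _ _ c00 cl0 b0; have [k' bk'] := pB _ _ c1 cl b0.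
case/eqP: b0N; apply: coprime_mulrn_eq0 bk bk'.
by rewrite coprimeXl // coprimeXr.
Qed.

(** * Finite degree over finite [p]-groups *)

Lemma weights_vanishes (A B : zmodType) r (e : 'I_r -> A) (al : 'I_r -> nat) p q beta
    (f : A -> B) :
    prime p -> (forall j, (0 < al j)%N) -> (forall j, e j *+ p ^ al j = 0) ->
    (forall j, ((p - 1) * p ^ (al j - 1) <= q)%N) -> (forall x, f x *+ p ^ beta = 0) ->
    generates e ->
  vanishes f (\sum_j (p ^ al j - 1) + (beta - 1) * q).
Proof.
move=> pp al0 eal leq_q fb gen s ss; apply: (Deltas_generators gen) ss => t st x.
by rewrite -[LHS](mulr1n) -(expn0 p) (Deltas_weight_eq0 pp al0 eal leq_q fb) // st mul0n addn0.
Qed.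

Lemma finite_pgroup_vanishes (A B : zmodType) p (f : A -> B) :
  prime p -> finite_group A -> pgroup p A -> pgroup p B -> exists n, vanishes f n.
Proof.
move=> pp [s sA] pA pB.
have [k Ak] := pgroup_seq_exponent s pA.
(* [f] has finitely many values, so one power of [p] kills them all even if [B] has infinite
   exponent. *)
have [l Bl] := pgroup_seq_exponent (map f s) pB.
pose e (j : 'I_(size s)) := nth 0 s j.
(* All elements of [A] serve as generators; [k.+1] makes the exponents positive. *)
eexists; apply: (@weights_vanishes _ _ _ e (fun=> k.+1) p ((p - 1) * p ^ k) l) => //.
- by move=> j; rewrite expnS mulnC mulrnA Ak ?mul0rn ?mem_nth.
- by move=> j; rewrite subSS subn0.
- by move=> x; apply: Bl; apply: map_f.
move=> P _ _ _ Pe a; have := sA a; rewrite -index_mem => ia.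
by rewrite -(nth_index 0 (sA a)); apply: (Pe (Ordinal ia)).
Qed.

(** * Cyclic decomposition of [A] *)

Section Presentation.
Variables (A : zmodType) (p : nat) (al : seq nat) (psi : 'rV[int]_(size al) -> A).
Hypothesis pres : presents p psi.

Definition presentation_basis (j : 'I_(size al)) : A := psi (delta_mx ord0 j).

Lemma presents_eq0 v :
  psi v = 0 <-> forall i : 'I_(size al), (((p ^ (nth 0%N al i))%N)%:Z %| v ord0 i)%Z.
Proof. by case: pres => _ []. Qed.

Lemma presentsD u v : psi (u + v) = psi u + psi v.
Proof. by case: pres. Qed.

Lemma presents0 : psi 0 = 0.
Proof. by apply/presents_eq0 => i; rewrite mxE. Qed.

Lemma presentsN v : psi (- v) = - psi v.
Proof. by apply/eqP; rewrite -addr_eq0 -presentsD addNr presents0. Qed.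

Lemma presents_sum_basis t :
  \sum_(j <- t) presentation_basis j = psi (\sum_(j <- t) delta_mx ord0 j).
Proof.
elim: t => [|j t IH]; first by rewrite !big_nil presents0.
by rewrite !big_cons presentsD IH.
Qed.

Lemma sum_basis_coord (t : seq 'I_(size al)) i :
  (\sum_(j <- t) delta_mx ord0 j : 'rV[int]_(size al)) ord0 i = (count_mem i t)%:Z.
Proof.
elim: t => [|j t IH]; first by rewrite big_nil mxE.
by rewrite big_cons mxE IH mxE eqxx /= eq_sym PoszD; case: (j == i).
Qed.

Lemma presents_basis_order j : presentation_basis j *+ p ^ nth 0%N al j = 0.
Proof.
have <- : \sum_(k <- nseq (p ^ nth 0%N al j) j) presentation_basis k =
    presentation_basis j *+ p ^ nth 0%N al j.
  by rewrite big_nseq iter_addr addr0.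
rewrite presents_sum_basis; apply/presents_eq0 => i; rewrite sum_basis_coord count_nseq /=.
by case: eqP => [->|_]; rewrite ?mul1n ?mul0n.
Qed.

(** The coordinates are multiplicities; one of them is positive and below [p ^ nth 0%N al j], hence
    not divisible by it. *)
Lemma presents_basis_free (t : seq 'I_(size al)) : t != [::] ->
    (forall j, (count_mem j t < p ^ nth 0%N al j)%N) ->
  \sum_(j <- t) presentation_basis j != 0.
Proof.
case: t => // j t _ tp; apply/eqP; rewrite presents_sum_basis => /presents_eq0 /(_ j).
rewrite sum_basis_coord dvdzE; apply/negP; apply: contraL (tp j) => pdv.
by rewrite -leqNgt (dvdn_leq _ pdv) //= eqxx.
Qed.

Lemma presents_generates : generates presentation_basis.
Proof.
move=> P P0 PD PN Pe a; have [_ [/(_ a)[v <-] _]] := pres.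
rewrite [v]row_sum_delta; elim/big_ind: _ => [|u w Pu Pw|j _].
- by rewrite presents0.
- by rewrite presentsD; apply: PD.
have Pn n : P (psi (n%:Z *: delta_mx ord0 j)).
  elim: n => [|n IH]; first by rewrite scale0r presents0.
  by rewrite intS scalerDl scale1r presentsD; apply: PD => //; apply: Pe.
by case: (v ord0 j) => n //; rewrite NegzE scaleNr presentsN; apply: PN.
Qed.

End Presentation.

(** * Exact value of [delta] for finite exponent *)

Lemma exists_seq_count (T : finType) (n : T -> nat) :
  exists t : seq T, forall j, count_mem j t = n j.
Proof.
exists (flatten [seq nseq (n j) j | j <- enum T]) => i.
rewrite count_flatten sumnE !big_map -big_enum /= big_enum (bigD1 i) //= count_nseq /= eqxx mul1n.
by rewrite big1 ?addn0 // => j /negPf ji; rewrite count_nseq /= ji.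
Qed.

Lemma presents_delta (A B : zmodType) p al beta (psi : 'rV[int]_(size al) -> A) :
    nontrivial A -> nontrivial B -> prime p -> sorted geq al ->
    all (fun a => 0 < a)%N al -> presents p psi -> exponent_is B (p ^ beta) ->
  delta A B = Fin (\sum_(a <- al) (p ^ a - 1) + (beta - 1) * (p - 1) * p ^ (head 0 al - 1))%N.
Proof.
move=> [a0 a0N] [b0 b0N] pp al_sorted al_pos pres [_ [Bexp Bmin]].
have p1 := prime_gt1 pp.
have al_size : (0 < size al)%N.
  rewrite lt0n; apply: contra a0N => /eqP r0; have [_ [/(_ a0)[v <-] _]] := pres.
  by apply/eqP/(presents_eq0 pres) => i; have := leq_trans (ltn_ord i) (eq_leq r0).
pose j0 := Ordinal al_size; pose al' (j : 'I_(size al)) := nth 0%N al j.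
have hd : head 0%N al = al' j0 by rewrite /al' nth0.
have al0 j : (0 < al' j)%N by apply: (allP al_pos); rewrite mem_nth.
have beta0 : (0 < beta)%N.
  by rewrite lt0n; apply: contra b0N => /eqP be0; have := Bexp b0; rewrite be0 mulr1n => ->.
pose q := ((p - 1) * p ^ (al' j0 - 1))%N.
have leq_q j : ((p - 1) * p ^ (al' j - 1) <= q)%N.
  rewrite leq_mul2l leq_exp2l // leq_sub2r ?orbT // -hd /al'.
  have : nth 0%N al j \in al by rewrite mem_nth.
  move: (nth _ _ _) => x; case: (al) al_sorted => //= a l /(order_path_min _) al_min.
  rewrite inE => /predU1P[-> //|]; apply/allP: x; apply: al_min.
  by move=> x y z /= xy zx; apply: leq_trans zx xy.
rewrite hd -mulnA -/q.
have -> : (\sum_(a <- al) (p ^ a - 1) = \sum_j (p ^ al' j - 1))%N.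
  by rewrite (big_nth 0%N) big_mkord.
set e := presentation_basis psi; have eal := presents_basis_order pres.
have pal j : (0 < p ^ al' j - 1)%N by rewrite subn_gt0 -{1}(expn0 p) ltn_exp2l.
have [b bN] : exists b : B, b *+ p ^ (beta - 1) != 0.
  apply: contrapT => bN; have : (p ^ beta <= p ^ (beta - 1))%N.
    apply: Bmin; first by rewrite expn_gt0 prime_gt0.
    by move=> b; apply/eqP/negPn/negP => bb; apply: bN; exists b.
  by rewrite leq_exp2l //; lia.
set N := (_ + _)%N.
have upper (f : A -> B) : vanishes f N.
  apply: weights_vanishes eal leq_q _ (presents_generates pres) => // x.
pose f := delta_fun (0 : A) b; apply: (delta_Fin (f := f)) => //.
have N0 : (0 < N)%N by rewrite /N (bigD1 j0) //= -!addnA ltn_addr.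
(* [vanishes f N.-1] is a statement about [N]-fold differences. *)
rewrite -(prednK N0); apply: fdeg_Fin; first by rewrite prednK.
have [T Tcount] := exists_seq_count (fun j => if j == j0 then 0%N else p ^ al' j - 1)%N.
have sT : (\sum_j (p ^ al' j - 1) = size T + (p ^ al' j0 - 1))%N.
  rewrite size_sum_count (eq_bigr _ (fun j _ => Tcount j)) (bigD1 j0) //= addnC; congr (_ + _)%N.
  by rewrite [RHS](bigD1 j0) //=; apply: eq_bigr => j /negPf ->.
move=> fN; set u := nseq (p ^ al' j0 - 1) j0 ++ T.
have ucount j : (count_mem j u < p ^ al' j)%N.
  have -> : (count_mem j u = p ^ al' j - 1)%N.
    rewrite count_cat count_nseq Tcount /= eq_sym; case: eqP => [->|_].
      by rewrite mul1n addn0.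
    by rewrite mul0n.
  by have := pal j; lia.
(* For [m = beta - 1] the premise is a plain [N]-fold difference; the conclusion is about [u], whose
   subfamilies are free of zero sums, so the difference there equals [b]. *)
have := @Deltas_weight_reduce _ _ _ e al' p q beta f pp al0 eal leq_q (fun x => Bexp _)
  j0 T (beta - 1) (- \sum_(a <- map e u) a) erefl sT.
rewrite foldr_Delta_delta_fun; last first.
  move=> m; rewrite size_map => sm mN; rewrite -map_mask big_map.
  apply: (presents_basis_free pres).
    by rewrite -size_eq0 size_mask // -lt0n -has_count.
  by move=> j; apply: leq_ltn_trans (ucount j); apply: leq_count_subseq; apply: mask_subseq.
move=> bE; case/eqP: bN; apply: bE; first by lia.
by rewrite fN ?mul0rn // size_map size_cat size_nseq prednK // /N sT addnC addnA.
Qed.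

Theorem theorem3p8 (A B : zmodType) :
  nontrivial A -> nontrivial B ->
  (* (a) *)
  (~ finite_group A ->
     (forall b : B, b != 0 -> fdeg (delta_fun (0 : A) b) = PosInf) /\ delta A B = PosInf) /\
  (* (b) *)
  ((~ exists p, [/\ prime p, finite_group A, pgroup p A & pgroup p B]) ->
     (exists b : B, fdeg (delta_fun (0 : A) b) = PosInf) /\ delta A B = PosInf) /\
  (* (c) *)
  (forall (p : nat) (al : seq nat) (beta : nat) (psi : 'rV[int]_(size al) -> A),
     prime p -> finite_group A -> pgroup p A ->
     sorted geq al -> all (fun a => 0 < a)%N al -> presents p psi ->
     pgroup p B -> exponent_is B (p ^ beta) ->
     delta A B = Fin ((\sum_(a <- al) (p ^ a - 1)) + (beta - 1) * (p - 1) * p ^ (head 0 al - 1))%N) /\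
  (* (d) *)
  (forall p : nat, prime p -> finite_group A -> pgroup p A ->
     pgroup p B -> infinite_exponent B ->
     (forall f : A -> B, fdeg f <> PosInf) /\ delta A B = PosInf).
Proof.
move=> nA nB; have [a aN] := nA; have [b0 b0N] := nB.
split; [|split; [|split]].
- move=> Ainf; split=> [b bN|].
    by apply: fdeg_PosInf => n; apply: infinite_vanishesN.
  by apply: delta_PosInf => n; exists (delta_fun 0 b0); apply: infinite_vanishesN.
- move=> noP; have [b bN] : exists b : B, forall n, ~ vanishes (delta_fun (0 : A) b) n.
    have [fA|Ainf] := pselect (finite_group A); first exact: finite_non_pgroup_vanishesN.
    by exists b0 => n; apply: infinite_vanishesN.
  split; first by exists b; apply: fdeg_PosInf.
  by apply: delta_PosInf => n; exists (delta_fun 0 b).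
- by move=> p al beta psi pp _ _ als alp pres _; apply: presents_delta pres.
- move=> p pp fA pA pB Binf; split=> [f|].
    have [n /fdeg_leP] := finite_pgroup_vanishes f pp fA pA pB.
    by case: (fdeg f).
  have [k ak] := pA a; have pk0 : (0 < p ^ k)%N by rewrite expn_gt0 prime_gt0.
  have [l [c [pl lpk c0 cl]]] := torsion_prime_order pk0 aN ak.
  have {lpk} lp : l = p by apply/eqP; move: lpk; rewrite Euclid_dvdX // dvdn_prime2 // => /andP[].
  (* Degree at most [n] would force [p ^ n] to kill [b]; infinite exponent supplies a [b] that
     escapes. *)
  apply: delta_PosInf => n; have [|b bN] := Binf (p ^ n)%N.
    by rewrite expn_gt0 prime_gt0.
  exists (delta_fun 0 b) => bn; case/eqP: bN.
  by rewrite -lp; apply: vanishes_delta_fun_torsion c0 cl bn.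
Qed.
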